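(* Suppose that: (A) $F:\mathbb{R}^d\to\mathbb{R}$ is continuously differentiable and $\|\nabla F(x')-\nabla F(x)\|_2\le L\|x'-x\|_2$ for all $x,x'\in\mathbb{R}^d$, with $0<L<\infty$; (B) $F$ is twice differentiable and bounded below by a scalar $F_{\inf}<\infty$, and the mapping $x\mapsto\|\nabla F(x)\|_2^2$ has Lipschitz-continuous derivatives with Lipschitz constant $L_G>0$; (C) the random directions satisfy the direction assumption of the context; (D) the variance assumption of the context holds with constants $M,M_V\ge0$; (E) $F$ is strongly convex with constant $l>0$, i.e. $F(x')\ge F(x)+\nabla F(x)^{\mathrm T}(x'-x)+\frac l2\|x'-x\|_2^2$ for all $x,x'\in\mathbb{R}^d$, with unique minimizer $x_*$ and $F_*=F(x_* )$. Let $p>0$ and let $\{x_k\}$ be generated by the accelerated method with momentum described in the context, with the (non-increasing) stepsizes $\alpha_k=\frac{\beta}{k+\sigma}$, where $\sigma>0$; $\beta>\frac1l$ and $\alpha_1\le\frac1{LM_G}$ with $M_G=M_V+2$; moreover $\beta>\frac4l$; and $\alpha_k\le\frac1L$ and $\alpha_k\le\frac1{LM_{G,p}^{(1)}}$ for all $k$. Suppose also that (F) $\mathbb{E}[F(x_j)]-F_*=\mathcal{O}(1/j)$, and (G) there is $D<\infty$ with $\|x_i-x_j\|_2\le D$ for all $i,j\in\mathbb{N}$. Then $$\lim_{k\to\infty}\mathbb{E}\big[\|\nabla F(x_k)\|_2^2\big]=0.$$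
   Context: $F(x)=\mathbb{E}_\xi[f(x,\xi)]=\int_\Xi f(x,\xi)\,dP(\xi)$ for a collection of real-valued functions $f(\cdot,\xi)$ on $\mathbb{R}^d$ and a probability distribution $P$ on $\Xi$. The stochastic step $s(x_k,\xi_k,\alpha_k,\zeta_k)$ is one of the following four choices ($n_k,q_k$ are positive integer sample sizes, all $\xi$'s are distributed as $P$, all $\zeta$'s with index $k$ as $\zeta_k$): (1) $(f(x_k,\xi_k)-f(x_k+\alpha_k\zeta_k,\xi_k))\zeta_k$; (2) $\frac1{n_k}\sum_{i=1}^{n_k}(f(x_k,\xi_{k,i})-f(x_k+\alpha_k\zeta_k,\xi_{k,i}))\zeta_k$; (3) $\frac1{n_k}\sum_{i=1}^{n_k}\big[\frac1{q_k}\sum_{j=1}^{q_k}(f(x_k,\xi_{k,i,j})-f(x_k+\alpha_k\zeta_{k,i},\xi_{k,i,j}))\big]\zeta_{k,i}$; (4) $\frac1{n_k}\sum_{i=1}^{n_k}(f(x_k,\xi_{k,i})-f(x_k+\alpha_k\zeta_{k,i},\xi_{k,i}))\zeta_{k,i}$. The random variables $\{\xi_k\}$, $\{\zeta_k\}$ are i.i.d. over $k$ and jointly independent, so that $\mathbb{E}_{\xi_k,\zeta_k}[s(x_k,\xi_k,\alpha_k,\zeta_k)]=\mathbb{E}_{\zeta_k}[(F(x_k)-F(x_k+\alpha_k\zeta_k))\zeta_k]$. Here $\mathbb{E}_{\xi_k,\zeta_k}$ is the expectation over the $k$-th seeds, and $\mathbb{E}=\mathbb{E}_{\xi_1,\zeta_1}\cdots\mathbb{E}_{\xi_k,\zeta_k}$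 is the total expectation over all random variables. Accelerated method with momentum: from a given $x_1\in\mathbb{R}^d$, $x_{k+1}=x_k+\alpha_km_k$ with $$m_k=\frac{1}{\sum_{i=1}^ki^p}\sum_{j=1}^k\frac{j^p}{\alpha_j}\,s(x_j,\xi_j,\alpha_j,\zeta_j).$$ (Equivalently $m_k=v_k/\sum_{j=1}^k\prod_{i=j}^k\gamma(i)$, $v_k=\gamma(k)v_{k-1}+\frac1{\alpha_k}s(x_k,\xi_k,\alpha_k,\zeta_k)$ with $v_0=0$, with decay factor $\gamma(k)=(\frac{k}{k+1})^p$.) Direction assumption: the $\zeta_k\in\mathbb{R}^d$ are i.i.d.; $\mathbb{E}[\zeta_k^{(i)}]=0$ for all $i$; $\mathbb{E}[\zeta_k^{(i)}\zeta_k^{(j)}]=1$ if $i=j$ and $0$ otherwise; and every component is bounded, $|\zeta_k^{(i)}|\le r_\zeta$ for all $i$, or has a finite nonzero fourth moment, $\mathbb{E}[(\zeta_k^{(i)})^4]\le m_\zeta^{(4)}$ for all $i$. Variance assumption: for all $k\in\mathbb{N}$, $\mathbb{V}_{\xi_k,\zeta_k}[s(x_k,\xi_k,\alpha_k,\zeta_k)]\le\alpha_k^2M+\alpha_k^2M_V\|\nabla F(x_k)\|_2^2$, where $\mathbb{V}_\theta[s]=\mathbb{E}_\theta[\|s\|_2^2]-\|\mathbb{E}_\theta[s]\|_2^2$. Constants: $C_p$ is a positive real constant with $\sum_{i=1}^ki^{2p}\big/\big(\sum_{i=1}^ki^p\big)^2\le C_p\alpha_k$ for all $k$, and $M_{G,p}^{(k)}=\frac32+2\alpha_kC_pM_V$.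 *)

(* Defs.v *)
From HB Require Import structures.
From mathcomp Require Import all_boot all_order all_algebra.
From mathcomp Require Import all_classical all_reals all_analysis.

Set Implicit Arguments.
Unset Strict Implicit.
Unset Printing Implicit Defensive.

Import Order.TTheory GRing.Theory Num.Theory.
Import numFieldNormedType.Exports.

Local Open Scope classical_set_scope.
Local Open Scope ring_scope.

Definition dot (R : realType) (d : nat) (u v : 'rV[R]_d) : R :=
  \sum_(i < d) u 0 i * v 0 i.

(* The library norm `|u| on row vectors is the maximum norm. *)
Definition norm2 (R : realType) (d : nat) (u : 'rV[R]_d) : R :=
  Num.sqrt (dot u u).

Definition grad (R : realType) (d : nat) (F : 'rV[R]_d -> R)
    (x : 'rV[R]_d) : 'rV[R]_d :=
  \row_(i < d) 'D_(delta_mx 0 i) F x.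

Definition lipschitz_grad (R : realType) (d : nat) (L : R)
    (F : 'rV[R]_d -> R) : Prop :=
  forall x x' : 'rV[R]_d,
    norm2 (grad F x' - grad F x) <= L * norm2 (x' - x).

Definition strongly_convex (R : realType) (d : nat) (l : R)
    (F : 'rV[R]_d -> R) : Prop :=
  forall x x' : 'rV[R]_d,
    F x' >= F x + dot (grad F x) (x' - x) + l / 2 * norm2 (x' - x) ^+ 2.

Definition unique_minimizer (R : realType) (d : nat) (F : 'rV[R]_d -> R)
    (xs : 'rV[R]_d) : Prop :=
  (forall x, F xs <= F x) /\ (forall y, (forall x, F y <= F x) -> y = xs).

Definition borel_rV (R : realType) (d : nat) :=
  g_sigma_algebraType (@open 'rV[R]_d).

Definition mean_rV (R : realType) (d : nat) (dO : measure_display)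
    (Omega : measurableType dO) (Pr : probability Omega R)
    (X : Omega -> 'rV[R]_d) : 'rV[R]_d :=
  \row_(a < d) fine 'E_Pr[fun w => (X w 0 a)%R]%E.

(* The second moment is kept in \bar R, so an upper bound on the variance by
   a real number forces X to be square-integrable. *)
Definition variance_rV (R : realType) (d : nat) (dO : measure_display)
    (Omega : measurableType dO) (Pr : probability Omega R)
    (X : Omega -> 'rV[R]_d) : \bar R :=
  ('E_Pr[fun w => (norm2 (X w) ^+ 2)%R]
   - ((norm2 (mean_rV Pr X) ^+ 2)%R)%:E)%E.

Definition mutually_independent (R : realType) (dO : measure_display)
    (Omega : measurableType dO) (Pr : probability Omega R) (I : eqType)
    (D : set I) (G : I -> set (set Omega)) : Prop :=
  forall (s : seq I) (E : I -> set Omega), uniq s ->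
    (forall t, t \in s -> D t /\ G t (E t)) ->
    Pr (\bigcap_(t in [set` s]) E t) = (\prod_(t <- s) Pr (E t))%E.

(* Seeds are stored as arrays: xi k i j are the samples of the noise seed of
   iteration k, and zeta k i those of its direction seed. A rule drawing fewer
   samples at iteration k reads only an initial part of the arrays. *)

(* inl k is the sigma-algebra of the whole noise seed of iteration k, inr k
   that of its whole direction seed. Independence is required between these
   whole seeds only; samples of the same batch need not be independent. *)
Definition seed_events (R : realType) (d : nat) (dO dX : measure_display)
    (Omega : measurableType dO) (Xi : measurableType dX)
    (xi : nat -> nat -> nat -> Omega -> Xi)
    (zeta : nat -> nat -> Omega -> borel_rV R d)
    (t : nat + nat) : set (set Omega) :=
  match t with
  | inl k => <<s [set E | exists i j (A : set Xi),
                     measurable A /\ E = xi k i j @^-1` A] >>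
  | inr k => <<s [set E | exists i (A : set (borel_rV R d)),
                     measurable A /\ E = zeta k i @^-1` A] >>
  end.

Definition seed_index (t : nat + nat) : nat :=
  match t with inl k => k | inr k => k end.

Definition iid_seeds (R : realType) (d : nat) (dO dX : measure_display)
    (Omega : measurableType dO) (Xi : measurableType dX)
    (Pr : probability Omega R) (PXi : probability Xi R)
    (xi : nat -> nat -> nat -> {RV Pr >-> Xi})
    (zeta : nat -> nat -> {RV Pr >-> borel_rV R d}) : Prop :=
  [/\ forall k i j (A : set Xi), (0 < k)%N -> measurable A ->
        distribution Pr (xi k i j) A = PXi A,
      forall k i k' i' (A : set (borel_rV R d)),
        (0 < k)%N -> (0 < k')%N -> measurable A ->
        distribution Pr (zeta k i) A = distribution Pr (zeta k' i') A
    & mutually_independent Pr [set t | (0 < seed_index t)%N]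
        (seed_events xi zeta)].

(* Equality with a real number forces the first and second moments to be
   finite, since 'E_Pr[_] is \bar R-valued. *)
Definition direction_assumption (R : realType) (d : nat)
    (dO : measure_display) (Omega : measurableType dO)
    (Pr : probability Omega R) (z : Omega -> 'rV[R]_d) : Prop :=
  [/\ forall a : 'I_d, ('E_Pr[fun w => (z w 0 a)%R] = 0)%E,
      forall a b : 'I_d,
        'E_Pr[fun w => (z w 0 a * z w 0 b)%R]%E = ((a == b)%:R : R)%:E
    & (exists r : R, forall a : 'I_d, {ae Pr, forall w, `|z w 0 a| <= r}) \/
      (exists m4 : R, forall a : 'I_d,
         (0 < 'E_Pr[fun w => (z w 0 a ^+ 4)%R] <= m4%:E)%E)].

Inductive step_rule :=
  SingleSample | NoiseBatch | NestedBatch | PairedBatch.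

(* xi and z are the seeds of one iteration, n and q its sample sizes. *)
Definition stoch_step (R : realType) (d : nat) (Xi : Type)
    (f : 'rV[R]_d -> Xi -> R) (rule : step_rule) (n q : nat) (alpha : R)
    (x : 'rV[R]_d) (xi : nat -> nat -> Xi) (z : nat -> 'rV[R]_d) : 'rV[R]_d :=
  match rule with
  | SingleSample =>
      (f x (xi 0%N 0%N) - f (x + alpha *: z 0%N) (xi 0%N 0%N)) *: z 0%N
  | NoiseBatch =>
      n%:R^-1 *: \sum_(i < n)
        (f x (xi i 0%N) - f (x + alpha *: z 0%N) (xi i 0%N)) *: z 0%N
  | NestedBatch =>
      n%:R^-1 *: \sum_(i < n)
        (q%:R^-1 * \sum_(j < q)
           (f x (xi i j) - f (x + alpha *: z i) (xi i j))) *: z i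
  | PairedBatch =>
      n%:R^-1 *: \sum_(i < n)
        (f x (xi i 0%N) - f (x + alpha *: z i) (xi i 0%N)) *: z i
  end.

(* s j is the stochastic step taken at iteration j, for j >= 1. *)
Definition momentum (R : realType) (d : nat) (p : R) (alpha : nat -> R)
    (s : nat -> 'rV[R]_d) (k : nat) : 'rV[R]_d :=
  (\sum_(1 <= i < k.+1) i%:R `^ p)^-1 *:
    \sum_(1 <= j < k.+1) (j%:R `^ p / alpha j) *: s j.

(* Main.v *)
Require Import Defs.
From HB Require Import structures.
From mathcomp Require Import all_boot all_order all_algebra.
From mathcomp Require Import all_classical all_reals all_analysis.
From mathcomp Require Import measurable_realfun.
From mathcomp Require Import ring lra.
Import Order.TTheory GRing.Theory Num.Theory.
Import numFieldNormedType.Exports.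
Local Open Scope classical_set_scope.
Local Open Scope ring_scope.

(** The rate E[F(x_k)] - F(x_* ) = O(1/k) controls the gradients because, for a
strongly convex F with L-Lipschitz gradient,
  |grad F(y)|^2 <= 4 L (F(y) - F(x_* )),
see [norm2_grad_le]. Taking expectations at y = x_k gives
  0 <= E|grad F(x_k)|^2 <= 4 L (E[F(x_k)] - F(x_* )) = O(1/k).

The rate bounds the real number attached to an expectation that could a priori
be infinite or meaningless, so F(x_k) has to be shown integrable. It is bounded
almost surely: the iterates stay within distance D of the deterministic point
x_1, and F is bounded on balls ([strongly_convex_le_ball]). It is a random
variable because every iterate is one ([measurable_iterate]): the stochastic
step is built from f, the seeds and the current iterate by measurable
operations, once the Borel sigma-algebra of row vectors is known to be
generated by the coordinates ([measurable_borel_rV]). *)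

(** * Inner product and Euclidean norm *)

Lemma norm2_sqr (R : realType) (d : nat) (u : 'rV[R]_d) :
  norm2 u ^+ 2 = dot u u.
Proof.
rewrite /norm2 sqr_sqrtr// /dot sumr_ge0// => i _.
by rewrite -expr2 sqr_ge0.
Qed.

Lemma norm2_ge0 (R : realType) (d : nat) (u : 'rV[R]_d) : 0 <= norm2 u.
Proof. exact: sqrtr_ge0. Qed.

Lemma dotDl (R : realType) (d : nat) (u v w : 'rV[R]_d) :
  dot (u + v) w = dot u w + dot v w.
Proof.
by rewrite /dot -big_split; apply: eq_bigr => i _; rewrite mxE mulrDl.
Qed.

Lemma dotZl (R : realType) (d : nat) (a : R) (u v : 'rV[R]_d) :
  dot (a *: u) v = a * dot u v.
Proof.
by rewrite /dot mulr_sumr; apply: eq_bigr => i _; rewrite mxE mulrA.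
Qed.

Lemma dotC (R : realType) (d : nat) (u v : 'rV[R]_d) : dot u v = dot v u.
Proof. by rewrite /dot; apply: eq_bigr => i _; rewrite mulrC. Qed.

Lemma norm2_sqrZ (R : realType) (d : nat) (a : R) (u : 'rV[R]_d) :
  norm2 (a *: u) ^+ 2 = a ^+ 2 * norm2 u ^+ 2.
Proof. by rewrite !norm2_sqr dotZl (dotC _ _ u) dotZl mulrA -expr2. Qed.

(** Young's inequality with the weights used below; it stands in for the
Cauchy-Schwarz inequality throughout. *)
Lemma dot_young (R : realType) (d : nat) (u v : 'rV[R]_d) :
  dot u v <= norm2 u ^+ 2 + norm2 v ^+ 2 / 4.
Proof.
rewrite !norm2_sqr /dot mulr_suml -big_split/=; apply: ler_sum => i _.
have := sqr_ge0 (u 0 i - v 0 i / 2); lra.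
Qed.

Lemma norm2_sqrD (R : realType) (d : nat) (u v : 'rV[R]_d) :
  norm2 (u + v) ^+ 2 <= 2 * norm2 u ^+ 2 + 2 * norm2 v ^+ 2.
Proof.
rewrite !norm2_sqr /dot !mulr_sumr -big_split/=; apply: ler_sum => i _.
rewrite mxE; have := sqr_ge0 (u 0 i - v 0 i); lra.
Qed.

(** * Convex functions with Lipschitz gradient *)

Lemma strongly_convex_tangent (R : realType) (d : nat) (l : R)
    (F : 'rV[R]_d -> R) (y z : 'rV[R]_d) :
  0 < l -> strongly_convex l F -> F y + dot (grad F y) (z - y) <= F z.
Proof.
move=> l0 /(_ y z); apply: le_trans; rewrite lerDl mulr_ge0 ?sqr_ge0//; lra.
Qed.

(** The gradient is dominated by the optimality gap. Convexity, used at the point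
reached from [y] by a gradient step of length 1/(2L), replaces the usual descent
lemma, so that no differentiation along segments is involved; the price is the
constant 4 L instead of 2 L. *)
Lemma norm2_grad_le (R : realType) (d : nat) (L l : R)
    (F : 'rV[R]_d -> R) (xs y : 'rV[R]_d) :
  0 < L -> lipschitz_grad L F -> 0 < l -> strongly_convex l F ->
  (forall z, F xs <= F z) ->
  norm2 (grad F y) ^+ 2 <= 4 * L * (F y - F xs).
Proof.
move=> L0 Flip l0 Fcvx Fmin.
set g := grad F y; set t := (2 * L)^-1; set z := y - t *: g.
have t0 : 0 < t by rewrite invr_gt0 mulr_gt0.
have tL : t * L = 2^-1 by rewrite /t; field; rewrite gt_eqF.
have yz : y - z = t *: g by rewrite /z opprB addrC subrK.
have := strongly_convex_tangent _ _ _ _ z y l0 Fcvx.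
rewrite yz dotC dotZl dotC.
have ->: grad F z = g + (grad F z - g) by rewrite addrC subrK.
rewrite dotDl -norm2_sqr.
have -> : dot (grad F z - g) g = - dot (g - grad F z) g.
  by rewrite -[grad F z - g]opprB -scaleN1r dotZl mulN1r.
(* The gradient moves by at most L * t * |g| = |g| / 2 along the step. *)
have h1 : dot (g - grad F z) g <= norm2 g ^+ 2 / 2.
  have := dot_young _ _ (g - grad F z) g.
  have : norm2 (g - grad F z) ^+ 2 <= norm2 g ^+ 2 / 4.
    have := Flip z y; rewrite -/g yz => /(lerXn2r 2) h.
    apply: le_trans (h _ _) _.
    - by rewrite nnegrE norm2_ge0.
    - by rewrite nnegrE mulr_ge0 ?norm2_ge0// ltW.
    by rewrite exprMn norm2_sqrZ mulrA -exprMn [L * t]mulrC tL; lra.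
  lra.
move=> h2; have := Fmin z => h3.
have h4 : t * (norm2 g ^+ 2 / 2) <= F y - F xs.
  have : t * (norm2 g ^+ 2 / 2) <= t * (norm2 g ^+ 2 - dot (g - grad F z) g).
    by rewrite ler_pM2l//; lra.
  lra.
have := ler_wpM2l (ltW L0) h4.
by rewrite mulrA [L * t]mulrC tL; lra.
Qed.

(** The tangent inequality at [y], read at the centre [x0], bounds F from above
by the gradient at [y], which the Lipschitz condition compares with the one
at [x0]. *)
Lemma strongly_convex_le_ball (R : realType) (d : nat) (L l D : R)
    (F : 'rV[R]_d -> R) (x0 y : 'rV[R]_d) :
  0 < L -> lipschitz_grad L F -> 0 < l -> strongly_convex l F ->
  norm2 (y - x0) <= D ->
  F y <= F x0 + 2 * (L * D) ^+ 2 + 2 * norm2 (grad F x0) ^+ 2 + D ^+ 2 / 4.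
Proof.
move=> L0 Flip l0 Fcvx yD.
have D0 : 0 <= D by rewrite (le_trans _ yD) ?norm2_ge0.
have := strongly_convex_tangent _ _ _ _ y x0 l0 Fcvx.
rewrite -[x0 - y]opprB -scaleN1r dotC dotZl mulN1r dotC.
have := dot_young _ _ (grad F y) (y - x0).
have h1 : norm2 (y - x0) ^+ 2 <= D ^+ 2.
  by rewrite lerXn2r ?nnegrE ?norm2_ge0.
have h2 : norm2 (grad F y - grad F x0) ^+ 2 <= (L * D) ^+ 2.
  rewrite lerXn2r ?nnegrE ?norm2_ge0 ?mulr_ge0// ?(ltW L0)//.
  by apply: le_trans (Flip _ _) _; rewrite ler_pM2l.
have := norm2_sqrD _ _ (grad F y - grad F x0) (grad F x0).
rewrite subrK; lra.
Qed.

(** * Measurability of the iterates *)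

(** Open sets of row vectors are countable unions of boxes with rational centres
and rational radii, and a box is a finite intersection of coordinate
conditions. *)
Lemma measurable_borel_rV (R : realType) (d : nat) (dO : measure_display)
    (Omega : measurableType dO) (X : Omega -> 'rV[R]_d) :
  (forall a, measurable_fun [set: Omega] (fun w => X w 0 a)) ->
  measurable_fun [set: Omega] (X : Omega -> borel_rV R d).
Proof.
move=> mX; apply: (@measurability _ _ _ (borel_rV R d) _ X (@open 'rV[R]_d)) => //.
move=> _ [A oA <-]; rewrite setTI.
pose B (cr : 'rV[rat]_d * rat) : set 'rV[R]_d :=
  ball (map_mx ratr cr.1 : 'rV[R]_d) (ratr cr.2 : R).
have -> : A = \bigcup_(cr in [set cr | 0 < (ratr cr.2 : R) /\ B cr `<=` A]) B cr.
  apply/seteqP; split => [y Ay|y [cr /= [_ BA]]]; last exact: BA.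
  have /nbhs_ballP[e /= e0 eA] : nbhs y A by exact: open_nbhs_nbhs.
  have [r] : exists r : rat, (ratr r : R) \in `]0, e / 2[.
    by apply: rat_in_itvoo; rewrite divr_gt0.
  rewrite in_itv/= => /andP[r0 re].
  have hc a : exists c : rat, (ratr c : R) \in `]y 0 a - ratr r, y 0 a + ratr r[.
    by apply: rat_in_itvoo; lra.
  have [c cP] := choice hc.
  have yB : B (\row_a c a, r) y.
    split => //= i j; rewrite !mxE ord1 /ball/= ltr_norml.
    by have := cP j; rewrite in_itv/= => /andP[? ?]; lra.
  exists (\row_a c a, r) => //=; split=> // z zB; apply: eA.
  apply: (@le_ball _ _ _ (ratr r + ratr r)); first lra.
  by apply: ball_triangle zB; exact/ball_sym.
rewrite bigcup_mkcond preimage_bigcup; apply: countable_bigcupT_measurable => //.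
move=> cr; case: ifPn => [|_]; last by rewrite preimage_set0.
rewrite inE/= => -[r0 _].
have -> : X @^-1` B cr = \bigcap_(a in [set: 'I_d])
    (fun w => X w 0 a) @^-1` ball (ratr (cr.1 0 a) : R) (ratr cr.2).
  apply/seteqP; split => w /=; first by move=> [_ Bw] a _; have := Bw 0 a; rewrite mxE.
  by move=> Bw; split => // i a; rewrite mxE ord1; exact: Bw.
apply: fin_bigcap_measurable => // a _.
rewrite -[X in measurable X]setTI; apply: mX => //.
exact: measurable_ball.
Qed.

Lemma measurable_continuous_rV (R : realType) (d : nat) (dO : measure_display)
    (Omega : measurableType dO) (X : Omega -> borel_rV R d) (h : 'rV[R]_d -> R) :
  continuous h -> measurable_fun [set: Omega] X ->
  measurable_fun [set: Omega] (h \o X).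
Proof.
move=> ch mX; apply: (measurability _ (RGenOpens.measurableE R)).
move=> _ [_ [a [b ->]] <-]; rewrite setTI comp_preimage -[X in measurable X]setTI.
apply: mX => //; apply: sub_sigma_algebra; apply: open_comp => //.
Qed.

Lemma measurable_stoch_step (R : realType) (d : nat) (dO dX : measure_display)
    (Omega : measurableType dO) (Xi : measurableType dX)
    (f : 'rV[R]_d -> Xi -> R) (rule : step_rule) (n q : nat) (alpha : R)
    (X : Omega -> borel_rV R d) (xi : nat -> nat -> Omega -> Xi)
    (z : nat -> Omega -> borel_rV R d) :
  measurable_fun [set: borel_rV R d * Xi] (fun u => f u.1 u.2) ->
  measurable_fun [set: Omega] X ->
  (forall i j, measurable_fun [set: Omega] (xi i j)) ->
  (forall i, measurable_fun [set: Omega] (z i)) ->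
  forall a, measurable_fun [set: Omega] (fun w =>
    stoch_step f rule n q alpha (X w) (fun i j => xi i j w) (fun i => z i w) 0 a).
Proof.
move=> mf mX mxi mz.
have mz0 i a : measurable_fun [set: Omega] (fun w => (z i w : 'rV[R]_d) 0 a).
  by apply: (measurable_continuous_rV _ _ _ _ (z i) (fun v => v 0 a)) => //;
     exact: coord_continuous.
have mX0 a : measurable_fun [set: Omega] (fun w => (X w : 'rV[R]_d) 0 a).
  by apply: (measurable_continuous_rV _ _ _ _ X (fun v => v 0 a)) => //;
     exact: coord_continuous.
have mfc (Y : Omega -> borel_rV R d) i j : measurable_fun setT Y ->
    measurable_fun [set: Omega] (fun w => f (Y w) (xi i j w)).
  move=> mY; apply: (measurableT_comp mf (measurable_fun_pair mY _)) => //.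
have mXz i : measurable_fun [set: Omega]
    ((fun w => (X w : 'rV[R]_d) + alpha *: (z i w : 'rV[R]_d)) : Omega -> borel_rV R d).
  apply: measurable_borel_rV => a.
  under eq_fun do rewrite !mxE.
  by apply: measurable_funD => //; apply: measurable_funM.
have mdiff i j k : measurable_fun [set: Omega]
    (fun w => f (X w) (xi i j w)
              - f ((X w : 'rV[R]_d) + alpha *: (z k w : 'rV[R]_d)) (xi i j w)).
  by apply: measurable_funB; [exact: mfc|exact: (mfc _ i j (mXz k))].
case: rule => a /=.
- under eq_fun do rewrite !mxE.
  exact: measurable_funM.
- under eq_fun do rewrite mxE summxE.
  apply: measurable_funM => //; apply: measurable_sum => i.
  under eq_fun do rewrite mxE.
  exact: measurable_funM.
- under eq_fun do rewrite mxE summxE.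
  apply: measurable_funM => //; apply: measurable_sum => i.
  under eq_fun do rewrite mxE.
  apply: measurable_funM => //; apply: measurable_funM => //.
  exact: measurable_sum.
- under eq_fun do rewrite mxE summxE.
  apply: measurable_funM => //; apply: measurable_sum => i.
  under eq_fun do rewrite mxE.
  exact: measurable_funM.
Qed.

(** The iterate [x k.+1] depends on all previous ones through the momentum, hence
the strong induction. *)
Lemma measurable_iterate (R : realType) (d : nat) (dO : measure_display)
    (Omega : measurableType dO) (p : R) (alpha : nat -> R)
    (step : nat -> 'rV[R]_d -> Omega -> 'rV[R]_d)
    (x : nat -> Omega -> 'rV[R]_d) (x1 : 'rV[R]_d) :
  (forall w, x 1%N w = x1) ->
  (forall k w, (0 < k)%N ->
     x k.+1 w = x k w
       + alpha k *: momentum p alpha (fun j => step j (x j w) w) k) ->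
  (forall k (X : Omega -> borel_rV R d), measurable_fun [set: Omega] X ->
     forall a, measurable_fun [set: Omega] (fun w => step k (X w) w 0 a)) ->
  forall k, (0 < k)%N ->
  measurable_fun [set: Omega] (x k : Omega -> borel_rV R d).
Proof.
move=> hx1 hx mstep; elim/ltn_ind => -[//|[_ _|k IH _]].
  by rewrite (_ : x 1%N = cst x1)//; exact/funext.
apply: measurable_borel_rV => a.
under eq_fun do rewrite hx// 2!mxE.
apply: measurable_funD.
  apply: (measurable_continuous_rV _ _ _ _ (x k.+1) (fun v => v 0 a)).
    exact: coord_continuous.
  exact: IH.
apply: measurable_funM => //; rewrite /momentum.
under eq_fun do rewrite mxE summxE [X in _ * X]big_add1 [X in _ * X]big_mkord.
apply: measurable_funM => //; apply: measurable_sum => j.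
under eq_fun do rewrite mxE.
by apply: measurable_funM => //; apply: mstep; apply: IH => //; rewrite ltnS; exact: ltn_ord.
Qed.

(** * Expectation of the optimality gap *)

(** The bounds on [Y] make it integrable. They are needed because [fine] sends an
infinite expectation to 0, for which the equality would fail. *)
Lemma expectation_subr_cst (R : realType) (dO : measure_display)
    (Omega : measurableType dO) (Pr : probability Omega R)
    (Y : Omega -> R) (c C : R) :
  measurable_fun [set: Omega] Y -> (forall w, c <= Y w) ->
  {ae Pr, forall w, Y w <= C} ->
  'E_Pr[fun w => (Y w - c)%R]%E = (fine 'E_Pr[Y]%E - c)%:E.
Proof.
move=> mY cY YC.
have mYc : measurable_fun [set: Omega] (fun w => Y w - c).
  exact: measurable_funB.
have iYc : Pr.-integrable [set: Omega] (fun w => (Y w - c)%:E).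
  apply/integrableP; split; first exact/measurable_EFinP.
  apply: (@le_lt_trans _ _ (\int[Pr]_w (cst `|C - c|%:E w))%E).
    apply: ae_ge0_le_integral => //.
    - by apply: measurableT_comp => //; exact/measurable_EFinP.
    - by move=> w _; rewrite lee_fin.
    - by apply: filterS YC => w YwC _ /=; rewrite lee_fin !ger0_norm; have := cY w; lra.
  by rewrite integral_cst//= probability_setT mule1 ltry.
have ic : Pr.-integrable [set: Omega] (EFin \o cst c).
  exact: finite_measure_integrable_cst.
have iY : Pr.-integrable [set: Omega] (fun w => (Y w)%:E).
  have := integrableD measurableT iYc ic.
  by apply: eq_integrable => // w _ /=; rewrite -EFinD subrK.
rewrite unlock.
under eq_integral do rewrite EFinB.
rewrite (integralB measurableT iY ic).
rewrite [X in (_ - X)%E](integral_cst Pr measurableT c%:E).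
rewrite [X in (_ * X)%E](probability_setT Pr) mule1 -(fineK (integrable_fin_num measurableT iY)).
by rewrite -EFinB fineK ?integrable_fin_num.
Qed.
Theorem theorem4p15 (R : realType) (d : nat)
    (* the probability space, the noise space and its law *)
    (dO dX : measure_display)
    (Omega : measurableType dO) (Pr : probability Omega R)
    (Xi : measurableType dX) (PXi : probability Xi R)
    (* the objective *)
    (f : 'rV[R]_d -> Xi -> R) (F : 'rV[R]_d -> R)
    (hf_meas : measurable_fun [set: borel_rV R d * Xi] (fun u => f u.1 u.2))
    (hf_int : forall x, PXi.-integrable [set: Xi] (fun v => (f x v)%:E))
    (hF : forall x, F x = \int[PXi]_v f x v)
    (* the seeds *)
    (xi : nat -> nat -> nat -> {RV Pr >-> Xi})
    (zeta : nat -> nat -> {RV Pr >-> borel_rV R d})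
    (hseeds : iid_seeds PXi xi zeta)
    (* the iterates *)
    (rule : step_rule) (n q : nat -> nat)
    (hn : forall k, (0 < k)%N -> (0 < n k)%N)
    (hq : forall k, (0 < k)%N -> (0 < q k)%N)
    (p : R) (alpha : nat -> R)
    (step : nat -> 'rV[R]_d -> Omega -> 'rV[R]_d)
    (hstep : forall k y w,
       step k y w = stoch_step f rule (n k) (q k) (alpha k) y
                      (fun i j => xi k i j w) (fun i => zeta k i w))
    (x : nat -> Omega -> 'rV[R]_d) (x1 : 'rV[R]_d)
    (hx1 : forall w, x 1%N w = x1)
    (hx : forall k w, (0 < k)%N ->
       x k.+1 w = x k w
         + alpha k *: momentum p alpha (fun j => step j (x j w) w) k)
    (* (A) *)
    (L : R) (hL : 0 < L)
    (hF_diff : forall y, differentiable F y)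
    (hF_C1 : continuous (grad F))
    (hF_lip : lipschitz_grad L F)
    (* (B) *)
    (hF_diff2 : forall y, differentiable (grad F) y)
    (Finf : R) (hFinf : forall y, Finf <= F y)
    (LG : R) (hLG : 0 < LG)
    (hG_lip : lipschitz_grad LG (fun y => norm2 (grad F y) ^+ 2))
    (* (C) *)
    (hdir : forall k i, (0 < k)%N -> direction_assumption Pr (zeta k i))
    (* (D): the expectation over the k-th seeds, x k w being held fixed *)
    (M MV : R) (hM : 0 <= M) (hMV : 0 <= MV)
    (hvar : forall k, (0 < k)%N ->
       {ae Pr, forall w,
          (variance_rV Pr (step k (x k w))
           <= (alpha k ^+ 2 * M
               + alpha k ^+ 2 * MV * norm2 (grad F (x k w)) ^+ 2)%:E)%E})
    (* (E) *)
    (l : R) (hl : 0 < l) (hF_cvx : strongly_convex l F)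
    (xs : 'rV[R]_d) (hxs : unique_minimizer F xs)
    (* exponent and stepsizes *)
    (hp : 0 < p)
    (beta sigma : R) (hsigma : 0 < sigma)
    (halpha : forall k, (0 < k)%N -> alpha k = beta / (k%:R + sigma))
    (hbeta1 : l^-1 < beta)
    (halpha1 : alpha 1%N <= (L * (MV + 2))^-1)
    (hbeta4 : 4 / l < beta)
    (halphaL : forall k, (0 < k)%N -> alpha k <= L^-1)
    (Cp : R) (hCp : 0 < Cp)
    (hCp_bound : forall k, (0 < k)%N ->
       (\sum_(1 <= i < k.+1) i%:R `^ (2 * p))
         / (\sum_(1 <= i < k.+1) i%:R `^ p) ^+ 2 <= Cp * alpha k)
    (halphaMG : forall k, (0 < k)%N ->
       alpha k <= (L * (3 / 2 + 2 * alpha 1%N * Cp * MV))^-1)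
    (* (F) *)
    (hrate : (fun j : nat => fine 'E_Pr[fun w => F (x j w)]%E - F xs)
             =O_\oo (fun j : nat => j%:R^-1 : R))
    (* (G) *)
    (D : R)
    (hD : {ae Pr, forall w, forall i j, (0 < i)%N -> (0 < j)%N ->
             norm2 (x i w - x j w) <= D}) :
  'E_Pr[fun w => (norm2 (grad F (x k w)) ^+ 2)%R]%E @[k --> \oo] --> 0%E.
Proof.
have mx k : (0 < k)%N -> measurable_fun [set: Omega] (x k : Omega -> borel_rV R d).
  apply: (measurable_iterate _ _ _ _ p alpha step x x1) => // {}k X mX a.
  under eq_fun do rewrite hstep.
  exact: (measurable_stoch_step _ _ _ _ _ _ f rule (n k) (q k) (alpha k) X (xi k) (zeta k)).
have [Fmin _] := hxs.
have mF k : (0 < k)%N -> measurable_fun [set: Omega] (fun w => F (x k w)).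
  move=> k0; apply: (measurable_continuous_rV _ _ _ _ (x k) F) (mx k k0).
  by move=> y; exact: differentiable_continuous.
have mG k : (0 < k)%N ->
    measurable_fun [set: Omega] (fun w => norm2 (grad F (x k w)) ^+ 2).
  move=> k0; under eq_fun do rewrite norm2_sqr /dot.
  apply: measurable_sum => i.
  have mgi : measurable_fun [set: Omega] (fun w => grad F (x k w) 0 i).
    apply: (measurable_continuous_rV _ _ _ _ (x k) (fun y => grad F y 0 i)) (mx k k0).
    by move=> y; apply: (continuous_comp (f := grad F) (g := fun v => v 0 i));
       [exact: hF_C1|exact: coord_continuous].
  exact: measurable_funM.
have [C FC] : exists C, forall k, (0 < k)%N -> {ae Pr, forall w, F (x k w) <= C}.
  (* The bound is read off from [strongly_convex_le_ball] centred at [x1]. *)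
  eexists => k k0; apply: filterS hD => w /(_ k 1%N k0 isT); rewrite hx1 => xD.
  exact: (strongly_convex_le_ball _ _ _ _ _ _ _ _ hL hF_lip hl hF_cvx xD).
have EF k : (0 < k)%N ->
    'E_Pr[fun w => (F (x k w) - F xs)%R]%E = (fine 'E_Pr[fun w => F (x k w)]%E - F xs)%:E.
  move=> k0; apply: expectation_subr_cst (FC k k0); first exact: mF.
  by move=> w; exact: Fmin.
have EG k : (0 < k)%N ->
    ('E_Pr[fun w => (norm2 (grad F (x k w)) ^+ 2)%R]
     <= (4 * L * (fine 'E_Pr[fun w => F (x k w)]%E - F xs))%R%:E)%E.
  move=> k0; rewrite EFinM -EF// unlock -ge0_integralZl//; last 3 first.
  - by apply/measurable_EFinP; apply: measurable_funB => //; exact: mF.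
  - by move=> w _; rewrite lee_fin subr_ge0.
  - by rewrite lee_fin mulr_ge0// ltW.
  apply: ge0_le_integral => //.
  - by move=> w _; rewrite lee_fin sqr_ge0.
  - exact/measurable_EFinP/mG.
  - apply/measurable_EFinP; apply: measurable_funM => //.
    by apply: measurable_funB => //; exact: mF.
  - by move=> w _; rewrite -EFinM lee_fin; exact: (norm2_grad_le _ _ _ l).
have /eqO_exP[K K0 /= rateK] := hrate.
apply: (@squeeze_cvge _ _ _ _ (cst 0%E) _ (fun k => (4 * L * K * k%:R^-1)%:E)).
- near=> k.
  have k0 : (0 < k)%N by near: k; exact: nbhs_infty_gt.
  apply/andP; split.
    by rewrite unlock integral_ge0// => w _; rewrite lee_fin sqr_ge0.
  apply: le_trans (EG k k0) _; rewrite lee_fin -[leRHS]mulrA ler_pM2l ?mulr_gt0//.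
  have : `|fine 'E_Pr[fun w => F (x k w)]%E - F xs| <= K * `|k%:R^-1| by near: k.
  rewrite [`|_^-1|]ger0_norm ?invr_ge0//; apply: le_trans; exact: ler_norm.
- exact: cvg_cst.
- apply: cvg_EFin; first exact: nearW.
  rewrite -[X in _ --> X](mulr0 (4 * L * K)); apply: cvgMr.
  by rewrite -cvg_shiftS; exact: cvg_harmonic.
Unshelve. all: end_near.
Qed.
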